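(* Let $0<|q|<1$ and $u\in\mathbb{C}$ with $|u|<1$. Then \[ \sum_{i,j\geq0}\frac{(-1)^{i+j}u^{i}q^{(i-j)^{2}}}{(q^{2};q^{2})_{i}(q^{2};q^{2})_{j}} =\frac{(u;q)_{\infty}(q;q^{2})_{\infty}}{(u;q^{2})_{\infty}^{2}}. \]
   Context: For $a\in\mathbb{C}$ and $|p|<1$: $(a;p)_0=1$, $(a;p)_n=\prod_{k=0}^{n-1}(1-ap^k)$, $(a;p)_\infty=\prod_{k\ge0}(1-ap^k)$. *)

(* Defs.v *)
From mathcomp Require Export all_boot all_order all_algebra finmap.
From mathcomp Require Export boolp classical_sets reals topology normedtype.
From mathcomp Require Export complex.
From mathcomp.analysis.showcase Require Export summability.

Set Implicit Arguments.
Unset Strict Implicit.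
Unset Printing Implicit Defensive.

Import GRing.Theory Num.Theory.
Import numFieldNormedType.Exports.

Local Open Scope ring_scope.
Local Open Scope classical_set_scope.

(* Everything is stated over an arbitrary numFieldType because that is where
   the library puts the norm topology; R[i] gets it by being a numFieldType. *)

Definition qpoch (K : numFieldType) (a p : K) (n : nat) : K :=
  \prod_(k < n) (1 - a * p ^+ k).

(* Since lim is total, this is only meaningful when the product converges,
   which it does for every complex a and p with `|p| < 1. *)
Definition qpoch_inf (K : numFieldType) (a p : K) : K :=
  lim (qpoch a p n @[n --> \oo]).

(* Unconditional convergence: the sums over finite sets of indices converge to
   l along the inclusion order. Over the complex numbers this amounts to
   absolute convergence, so no order of summation is being chosen. *)
Definition has_sum (K : numFieldType) (I : choiceType) (f : I -> K) (l : K) :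
    Prop :=
  partial_sum f @ totally --> l.

(* Main.v *)
(** Write p = q^2. For fixed i, the sum over j of (-1)^j q^((i-j)^2) / (p;p)_j is
    (-1)^i (q;p)_i (q;p)_oo: the case i = 0 is Euler's series for (q;p)_oo, and
    the sums for i and i+1 are related by a two-term recurrence. What remains is
    (q;p)_oo times the sum over i of (q;p)_i u^i / (p;p)_i, which the q-binomial
    theorem evaluates to (q u;p)_oo / (u;p)_oo; finally
    (u;q)_oo = (u;p)_oo (q u;p)_oo. The iteration of sums is legitimate because
    the (i, j) term is bounded by C t^(i+j) for some t < 1. *)

Require Import Defs.
From mathcomp Require Import sequences exp.
From mathcomp Require Import zify ring.

Set Implicit Arguments.
Unset Strict Implicit.
Unset Printing Implicit Defensive.

Import Order.TTheory GRing.Theory Num.Theory.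
Import numFieldNormedType.Exports.

Local Open Scope ring_scope.
Local Open Scope complex_scope.
Local Open Scope classical_set_scope.

(** * Norms and limits of sequences in [R[i]] *)

Lemma nonneg_complexE (R : realType) (x : R[i]) :
  0 <= x -> exists2 r : R, 0 <= r & x = r%:C.
Proof.
move=> x0; have /complex_realP[r xE] := ger0_real x0.
by exists r => //; rewrite -ler0c -xE.
Qed.

Lemma norm_real_complex (R : realType) (r : R) : `|r%:C| = `|r|%:C :> R[i].
Proof. by rewrite normc_def /= expr0n /= addr0 sqrtr_sqr. Qed.

Lemma norm_le_Re_Im (R : realType) (z : R[i]) : `|z| <= (`|complex.Re z| + `|complex.Im z|)%:C.
Proof.
rewrite {1}[z]complexE (le_trans (ler_normD _ _))// normrM !norm_real_complex.
by rewrite normc_def /= expr0n expr1n add0r sqrtr1 mul1r rmorphD.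
Qed.

(* [R[i]] carries its topology only through its numFieldType structure;
   convergence is stated over an abstract [K] so that the structure is found. *)
Definition tendsto (K : numFieldType) (x : nat -> K) (l : K) : Prop :=
  x n @[n --> \oo] --> l.

Lemma tendstoP (K : numFieldType) (x : nat -> K) (l : K) :
  tendsto x l <-> forall e, 0 < e -> \forall n \near \oo, `|l - x n| < e.
Proof. by split=> [/cvgrPdist_lt|?]; [|apply/cvgrPdist_lt]. Qed.

Lemma tendsto_cst (K : numFieldType) (a : K) : tendsto (fun=> a) a.
Proof. exact: cvg_cst. Qed.
Arguments tendsto_cst {K} a.

Lemma tendstoD (K : numFieldType) (x y : nat -> K) (a b : K) :
  tendsto x a -> tendsto y b -> tendsto (fun n => x n + y n) (a + b).
Proof. exact: cvgD. Qed.

Lemma tendstoB (K : numFieldType) (x y : nat -> K) (a b : K) :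
  tendsto x a -> tendsto y b -> tendsto (fun n => x n - y n) (a - b).
Proof. exact: cvgB. Qed.

Lemma tendstoM (K : numFieldType) (x y : nat -> K) (a b : K) :
  tendsto x a -> tendsto y b -> tendsto (fun n => x n * y n) (a * b).
Proof. exact: cvgM. Qed.

Lemma tendsto_comp (K : numFieldType) (x : nat -> K) (a : K) (f : nat -> nat) :
  {homo f : m n / (m < n)%N} -> tendsto x a -> tendsto (x \o f) a.
Proof.
move=> fi /tendstoP xa; apply/tendstoP => e /xa[N _ xN]; exists N => // n /= Nn.
apply: xN => /=; apply: leq_trans Nn _.
by elim: n => // n; move/leq_ltn_trans; apply; exact: fi.
Qed.

Lemma tendsto_unique (K : numFieldType) (x : nat -> K) (a b : K) :
  tendsto x a -> tendsto x b -> a = b.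
Proof. by move=> xa xb; apply: (@cvg_unique _ (@norm_hausdorff K K) _ _ _ _ xa xb). Qed.

Lemma tendsto_squeeze (K : numFieldType) (x y : nat -> K) (a : K) :
  (forall n, `|x n - a| <= y n) -> tendsto y 0 -> tendsto x a.
Proof.
move=> xy /tendstoP y0; apply/tendstoP => e /y0; apply: filterS => n.
rewrite sub0r normrN distrC; apply: le_lt_trans.
by apply: le_trans (xy n) _; rewrite real_ler_norm// ger0_real// (le_trans _ (xy n)).
Qed.

(** Closed balls are closed: were [|a - b|] above [B], a term closer to [a] than the gap
    [|a - b| - B] would break the bound. *)
Lemma tendsto_norm_le (K : numFieldType) (x : nat -> K) (a b B : K) :
  0 <= B -> tendsto x a -> (\forall n \near \oo, `|x n - b| <= B) ->
  `|a - b| <= B.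
Proof.
move=> B0 /tendstoP xa xB; rewrite real_leNgt ?ger0_real//; apply/negP => aB.
have [n [xan xbn]] : exists n, `|a - x n| < `|a - b| - B /\ `|x n - b| <= B.
  apply: (@filter_ex _ \oo); near=> n; split; near: n => //.
  by apply: xa; rewrite subr_gt0.
have := ler_distD (x n) a b.
by apply/negP; rewrite -real_ltNge ?realD// -(subrK B `|a - b|) ltr_leD.
Unshelve. all: by end_near. Qed.

Lemma tendsto_complex (R : realType) (x : nat -> R[i]) (a b : R) :
  tendsto (@complex.Re R \o x) a -> tendsto (@complex.Im R \o x) b ->
  tendsto x (a +i* b).
Proof.
move=> /tendstoP xa /tendstoP xb; apply/tendstoP => e e0.
have [d d0 eE] := nonneg_complexE (ltW e0).
have {}d0 : 0 < d / 2 by rewrite divr_gt0// -ltcR -eE.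
near=> n.
have -> : a +i* b - x n = (a - complex.Re (x n)) +i* (b - complex.Im (x n)).
  by case: (x n).
rewrite (le_lt_trans (norm_le_Re_Im _))//= eE ltcR [ltRHS]splitr ltrD//.
  by near: n; exact: xa.
by near: n; exact: xb.
Unshelve. all: by end_near. Qed.

(** * Geometric domination: bounded products and convergent sequences *)

Lemma tendsto_geometric (R : realType) (a r : R[i]) : 0 <= r -> r < 1 ->
  tendsto (fun n => a * r ^+ n) 0.
Proof.
move=> /nonneg_complexE[s s0 ->]; rewrite ltcR => s1.
rewrite -(mulr0 a); apply: tendstoM; first exact: tendsto_cst.
apply: tendsto_complex; rewrite /comp.
  have -> : (fun n => complex.Re (s%:C ^+ n)) = (fun n => s ^+ n).
    by apply/funext => n; rewrite -rmorphXn.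
  by apply: cvg_expr; rewrite ger0_norm.
have -> : (fun n => complex.Im (s%:C ^+ n)) = (fun n => 0).
  by apply/funext => n; rewrite -rmorphXn.
exact: tendsto_cst.
Qed.

(** Each factor satisfies [1 + x <= expR x], and the exponents sum to at most [b / (1 - r)]. *)
Lemma prod_geometric_bound (R : realType) (b r : R[i]) :
  0 <= b -> 0 <= r -> r < 1 ->
  exists2 M : R[i], 0 <= M & forall n, \prod_(k < n) (1 + b * r ^+ k) <= M.
Proof.
move=> /nonneg_complexE[c c0 ->] /nonneg_complexE[s s0 ->]; rewrite ltcR => s1.
exists (expR (c / (1 - s)))%:C => [|n]; first by rewrite ler0c expR_ge0.
have -> : \prod_(k < n) (1 + c%:C * s%:C ^+ k) =
    (\prod_(k < n) (1 + c * s ^+ k))%:C.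
  by rewrite rmorph_prod; apply: eq_bigr => k _; rewrite rmorphD rmorphM rmorphXn.
rewrite lecR (@le_trans _ _ (\prod_(k < n) expR (c * s ^+ k)))//.
  apply: ler_prod => k _; rewrite expR_ge1Dx andbT.
  by rewrite addr_ge0// mulr_ge0// exprn_ge0.
rewrite -expR_sum ler_expR -mulr_sumr ler_wpM2l//.
have s1n : 1 - s != 0 by rewrite subr_eq0 eq_sym lt_eqF.
rewrite -[leLHS](mulKf s1n) -[leRHS]mulr1 ler_wpM2l ?invr_ge0 ?subr_ge0 ?(ltW s1)//.
by rewrite -opprB mulNr -subrX1 opprB lerBlDr lerDl exprn_ge0.
Qed.

Lemma telescope_dist (K : numFieldType) (x : nat -> K) (C r : K) :
  0 <= r -> r < 1 -> (forall n, `|x n.+1 - x n| <= C * r ^+ n) ->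
  forall m n, `|x (n + m)%N - x n| <= C * r ^+ n / (1 - r).
Proof.
move=> r0 r1 xC m n; have C0 : 0 <= C.
  by have := le_trans (normr_ge0 _) (xC 0%N); rewrite expr0 mulr1.
have s0 : 0 < 1 - r by rewrite subr_gt0.
rewrite ler_pdivlMr//.
(* The extra factor [1 - r ^+ m], a finite geometric sum times [1 - r], is what lets the induction
   on [m] close. *)
suff : `|x (n + m)%N - x n| * (1 - r) <= C * r ^+ n * (1 - r ^+ m).
  move/le_trans; apply; rewrite ler_piMr//; first by rewrite mulr_ge0 ?exprn_ge0.
  by rewrite lerBlDr lerDl exprn_ge0.
elim: m => [|m ihm]; first by rewrite addn0 !subrr normr0 mul0r mulr0.
rewrite addnS -[_ - _](subrKA (x (n + m)%N)).
rewrite (le_trans (ler_wpM2r (ltW s0) (ler_normD _ _)))// mulrDl.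
rewrite (le_trans (lerD (ler_wpM2r (ltW s0) (xC _)) ihm))// exprD exprS.
by rewrite le_eqVlt; apply/orP; left; apply/eqP; ring.
Qed.

(** Completeness of the reals is applied to the real and imaginary parts. The explicit rate gives
    the uniform row errors of the double sum and the behaviour of the q-binomial series near 0. *)
Lemma geometric_steps_cvg (R : realType) (x : nat -> R[i]) (C r : R[i]) :
  0 <= r -> r < 1 -> (forall n, `|x n.+1 - x n| <= C * r ^+ n) ->
  exists2 l, tendsto x l & forall n, `|x n - l| <= C * r ^+ n / (1 - r).
Proof.
move=> r0 r1 xC.
have C0 : 0 <= C.
  by have := le_trans (normr_ge0 _) (xC 0%N); rewrite expr0 mulr1.
have xd := telescope_dist r0 r1 xC.
have [c c0 CE] := nonneg_complexE C0; have [s s0 rE] := nonneg_complexE r0.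
have s1 : s < 1 by rewrite -ltcR -rE.
(* [f] will be [Re] or [Im]; its telescoping series of increments is dominated by a real geometric
   series. *)
have ex_lim (f : R[i] -> R) : {morph f : z w / z - w} ->
    (forall z, `|f z| <= complex.Re `|z|) -> exists l, tendsto (f \o x) l.
  move=> fB fz; pose y n := f (x n.+1 - x n).
  have : cvgn (series y).
    apply: normed_cvg; apply: series_le_cvg (is_cvg_geometric_series _).
    - by move=> n; exact: normr_ge0.
    - by move=> n; exact: (@geometric_ge0 _ c s).
    - move=> n /=; rewrite (le_trans (fz _))//; have := xC n.
      by rewrite lecE CE rE -rmorphXn -rmorphM => /andP[].
    - by rewrite ger0_norm.
  move=> /cvg_ex[l yl]; exists (l + f (x 0%N)).
  have -> : f \o x = (fun n => series y n + f (x 0%N)).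
    apply/funext => n; rewrite /series /y /=.
    under eq_bigr do rewrite fB.
    by rewrite telescope_sumr// subrK.
  by apply: tendstoD => //; exact: tendsto_cst.
have [a xa] : exists l, tendsto (@complex.Re R \o x) l.
  apply: ex_lim => [[? ?] [? ?]//|z].
  by rewrite normc_def/= -[leLHS]sqrtr_sqr ler_wsqrtr// lerDl sqr_ge0.
have [b xb] : exists l, tendsto (@complex.Im R \o x) l.
  apply: ex_lim => [[? ?] [? ?]//|z].
  by rewrite normc_def/= -[leLHS]sqrtr_sqr ler_wsqrtr// lerDr sqr_ge0.
exists (a +i* b); first exact: tendsto_complex.
move=> n; rewrite distrC; apply: tendsto_norm_le (tendsto_complex xa xb) _.
  by rewrite divr_ge0 ?subr_ge0 ?(ltW r1)// mulr_ge0// exprn_ge0.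
near=> m; have nm : (n <= m)%N by near: m; exact: nbhs_infty_ge.
by rewrite -(subnKC nm).
Unshelve. all: by end_near. Qed.

(** * Unconditional sums over pairs and iterated summation *)

Lemma sum_geometric (K : fieldType) (t : K) (n : nat) : t != 1 ->
  \sum_(k < n) t ^+ k = (1 - t ^+ n) / (1 - t).
Proof.
rewrite -subr_eq0 -oppr_eq0 opprB => t1.
by apply: (canRL (mulfK t1)); rewrite mulrC -[1 - t]opprB mulNr -subrX1 opprB.
Qed.

Lemma has_sum_dist (K : numFieldType) (I : choiceType) (f : I -> K) (l : K) :
  (forall e, 0 < e -> exists A : {fset I},
    forall B : {fset I}, (A `<=` B)%fset -> `|l - \sum_(x <- B) f x| < e) ->
  has_sum f l.
Proof.
move=> fl; apply/(@cvgrPdist_lt K K _ _ totally_filter) => e /fl[A AB].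
by exists A => // B /= /AB; rewrite /partial_sum big_seq_fsetE.
Qed.

Lemma sum_uniq_sub (I : eqType) (V : zmodType) (s r : seq I) (F : I -> V) :
  uniq s -> uniq r -> {subset s <= r} ->
  \sum_(x <- r) F x = \sum_(x <- s) F x + \sum_(x <- r | x \notin s) F x.
Proof.
move=> us ur sr; rewrite (bigID (mem s)) /=; congr (_ + _).
rewrite -big_filter; apply: perm_big; apply: uniq_perm => //.
  exact: filter_uniq.
by move=> x; rewrite mem_filter; case: (boolP (x \in s)) => // /sr ->.
Qed.

Definition square (n : nat) : seq (nat * nat) :=
  [seq (i, j) | i <- index_iota 0 n, j <- index_iota 0 n].

Lemma square_uniq n : uniq (square n).
Proof. by apply: allpairs_uniq; rewrite ?iota_uniq// => -[? ?] [? ?]. Qed.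

Lemma mem_square n x : (x \in square n) = (x.1 < n)%N && (x.2 < n)%N.
Proof.
case: x => i j; apply/allpairsP/andP => /=.
  by move=> [[k m]] /= [+ + [-> ->]]; rewrite !mem_index_iota.
by move=> [ni nj]; exists (i, j); rewrite !mem_index_iota.
Qed.

Lemma sum_square (V : zmodType) (F : nat * nat -> V) n :
  \sum_(x <- square n) F x = \sum_(i < n) \sum_(j < n) F (i : nat, j : nat).
Proof.
rewrite big_allpairs big_mkord; apply: eq_bigr => i _.
by rewrite big_mkord.
Qed.

Lemma fset_sub_square (B : {fset nat * nat}) :
  exists n, {subset B <= square n}.
Proof.
(* This sum strictly exceeds both coordinates of every member of [B], since each member contributes
   [x.1 + x.2 + 1]. *)
exists (\sum_(x <- B) (x.1 + x.2).+1)%N => x xB.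
rewrite mem_square (big_fsetD1 x xB) /=; lia.
Qed.

(** A discrete Fubini theorem: the geometric majorant controls both the row tails inside a square
    and everything outside it. *)
Lemma has_sum_iterated (R : realType) (f : nat * nat -> R[i]) (C t : R[i])
    (G : nat -> R[i]) (l : R[i]) :
  0 <= t -> t < 1 -> (forall i j, `|f (i, j)| <= C * t ^+ (i + j)) ->
  (forall i, tendsto (fun n => \sum_(j < n) f (i, j : nat)) (G i)) ->
  tendsto (fun n => \sum_(i < n) G i) l ->
  has_sum f l.
Proof.
move=> t0 t1 fC fG Gl.
have C0 : 0 <= C.
  by have := le_trans (normr_ge0 _) (fC 0%N 0%N); rewrite expr0 mulr1.
have s0 : 0 < 1 - t by rewrite subr_gt0.
have s0n : 1 - t != 0 by rewrite gt_eqF.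
have t1n : t != 1 by rewrite lt_eqF.
have geo_le n : \sum_(k < n) t ^+ k <= (1 - t)^-1.
  by rewrite sum_geometric// ler_piMl ?invr_ge0 ?(ltW s0)// lerBlDr lerDl exprn_ge0.
have row i n : `|\sum_(j < n) f (i, j : nat) - G i| <= C * t ^+ i * t ^+ n / (1 - t).
  have [m|L fL Lb] := @geometric_steps_cvg R
      (fun n => \sum_(j < n) f (i, j : nat)) (C * t ^+ i) t t0 t1.
    by rewrite big_ord_recr/= [X in `|X - _|]addrC addrK -mulrA -exprD.
  by rewrite (tendsto_unique (fG i) fL).
(* A square sum is the sum of [n] row limits plus [n] row errors, and the errors total at most
   [C * t ^+ n / (1 - t) ^+ 2]. *)
have Sl : tendsto (fun n => \sum_(x <- square n) f x) l.
  have -> : (fun n => \sum_(x <- square n) f x) = (fun n =>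
      (\sum_(i < n) (\sum_(j < n) f (i : nat, j : nat) - G i)) + \sum_(i < n) G i).
    by apply/funext => n; rewrite sum_square sumrB subrK.
  rewrite -[l]add0r; apply: tendstoD => //.
  apply: tendsto_squeeze (tendsto_geometric (C / (1 - t) / (1 - t)) t0 t1) => n.
  rewrite subr0 (le_trans (ler_norm_sum _ _ _))//.
  rewrite (le_trans (ler_sum _ (fun (i : 'I_n) _ => row i n)))//.
  have -> : \sum_(i < n) C * t ^+ i * t ^+ n / (1 - t) =
      C * t ^+ n / (1 - t) * \sum_(i < n) t ^+ i.
    by rewrite mulr_sumr; apply: eq_bigr => i _; field.
  have -> : C / (1 - t) / (1 - t) * t ^+ n = C * t ^+ n / (1 - t) * (1 - t)^-1.
    by field.
  by rewrite ler_wpM2l// mulr_ge0 ?invr_ge0 ?(ltW s0)// mulr_ge0 ?exprn_ge0.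
pose g (x : nat * nat) := C * t ^+ (x.1 + x.2).
have g0 x : 0 <= g x by rewrite mulr_ge0// exprn_ge0.
have fg x : `|f x| <= g x by case: x => i j; exact: fC.
have g_square n : \sum_(x <- square n) g x = C * (\sum_(k < n) t ^+ k) ^+ 2.
  rewrite sum_square expr2 mulr_suml mulr_sumr; apply: eq_bigr => i _.
  by rewrite !mulr_sumr; apply: eq_bigr => j _; rewrite /g/= exprD.
(* The mass of the majorant [g] outside [square n]: its full mass [C / (1 - t) ^+ 2] minus its mass
   on the square. *)
pose tail n := C / (1 - t) ^+ 2 * (1 - (1 - t ^+ n) ^+ 2).
have tail0 : tendsto tail 0.
  have -> : 0 = C / (1 - t) ^+ 2 * (1 - (1 - 0) ^+ 2) :> R[i].
    by rewrite subr0 expr1n subrr mulr0.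
  have t_cvg : tendsto (fun n => 1 - t ^+ n) (1 - 0).
    rewrite (_ : (fun n => _) = (fun n => 1 - 1 * t ^+ n)).
      by apply: tendstoB; [exact: tendsto_cst|exact: tendsto_geometric].
    by apply/funext => n; rewrite mul1r.
  apply: tendstoM; first exact: tendsto_cst.
  by apply: tendstoB; [exact: tendsto_cst|exact: tendstoM].
apply: has_sum_dist => e e0; have e20 : 0 < e / 2 by rewrite divr_gt0.
have [n [nl nt]] : exists n,
    `|l - \sum_(x <- square n) f x| < e / 2 /\ `|0 - tail n| < e / 2.
  apply: (@filter_ex _ \oo); near=> n; split; near: n.
    by move/tendstoP : Sl; apply.
  by move/tendstoP : tail0; apply.
exists [fset x in square n]%fset => B nB.
have sB : {subset square n <= B}.
  by move=> x xn; apply: (fsubsetP nB); rewrite in_fset.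
have [m Bm] := fset_sub_square B.
have un := square_uniq n; have uB := fset_uniq B.
(* What [B] adds to the square is bounded by the mass of [g] on [B] minus that on [square n];
   enclosing [B] in [square m] bounds the former by the full mass. *)
have nBf : `|\sum_(x <- square n) f x - \sum_(x <- B) f x| <= tail n.
  rewrite (sum_uniq_sub f un uB sB) opprD addNKr normrN.
  rewrite (le_trans (ler_norm_sum _ _ _))// (le_trans (ler_sum _ (fun x _ => fg x)))//.
  have -> : \sum_(x <- B | x \notin square n) g x =
      \sum_(x <- B) g x - \sum_(x <- square n) g x.
    by rewrite (sum_uniq_sub g un uB sB) addrC addKr.
  have : \sum_(x <- B) g x <= C * (1 - t)^-1 ^+ 2.
    rewrite (@le_trans _ _ (\sum_(x <- square m) g x))//.
      by rewrite (sum_uniq_sub g uB (square_uniq m) Bm) lerDl sumr_ge0.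
    rewrite g_square ler_wpM2l// lerXn2r// nnegrE ?invr_ge0 ?(ltW s0)//.
    by rewrite sumr_ge0// => k _; rewrite exprn_ge0.
  rewrite g_square sum_geometric// => le_g.
  have -> : tail n = C * (1 - t)^-1 ^+ 2 - C * ((1 - t ^+ n) / (1 - t)) ^+ 2.
    by rewrite /tail; field.
  by rewrite lerB.
rewrite (le_lt_trans (ler_distD (\sum_(x <- square n) f x) _ _))//.
rewrite [e]splitr ltrD// (le_lt_trans nBf)//.
move: nt; rewrite sub0r normrN; apply: le_lt_trans.
by rewrite real_ler_norm// ger0_real// (le_trans _ nBf).
Unshelve. all: by end_near. Qed.

(** * q-Pochhammer symbols and the q-binomial series *)

Lemma qpochS (K : numFieldType) (a p : K) n :
  qpoch a p n.+1 = qpoch a p n * (1 - a * p ^+ n).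
Proof. exact: big_ord_recr. Qed.

Lemma qpoch_infE (K : numFieldType) (a p l : K) :
  tendsto (qpoch a p) l -> qpoch_inf a p = l.
Proof. by move=> al; apply: (@cvg_lim K (@norm_hausdorff K K) _ _ _ _ _ al). Qed.

(** Consecutive partial products differ by [a * p ^+ n] times a bounded product, so the steps decay
    geometrically. *)
Lemma qpoch_cvg (R : realType) (a p : R[i]) :
  `|p| < 1 -> tendsto (qpoch a p) (qpoch_inf a p).
Proof.
move=> p1.
have [M M0 bM] := prod_geometric_bound (normr_ge0 a) (normr_ge0 p) p1.
have [n|l al _] := @geometric_steps_cvg R (qpoch a p) (M * `|a|) `|p|
  (normr_ge0 p) p1.
  rewrite qpochS mulrBr mulr1 addrC addKr normrN !normrM normrX mulrA.
  rewrite ler_wpM2r ?exprn_ge0// ler_wpM2r// (le_trans _ (bM n))//.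
  rewrite normr_prod ler_prod// => k _; rewrite normr_ge0/=.
  by rewrite (le_trans (ler_normB _ _))// normr1 normrM normrX.
by rewrite (qpoch_infE al).
Qed.
Arguments qpoch_cvg {R} a {p}.

Lemma qpoch0 (K : numFieldType) (p : K) n : qpoch 0 p n = 1.
Proof. by rewrite /qpoch big1// => k _; rewrite mul0r subr0. Qed.

Lemma qpoch_inf0 (K : numFieldType) (p : K) : qpoch_inf 0 p = 1.
Proof.
apply: qpoch_infE; rewrite (_ : qpoch 0 p = fun=> 1); first exact: tendsto_cst.
by apply/funext => n; exact: qpoch0.
Qed.

(* The coefficients of [(b x; p)_oo / (a x; p)_oo]: [a = 1] is the q-binomial
   theorem, while [a = 0], [b = 1] is Euler's series for [(x; p)_oo]. *)
Definition qcoef (K : numFieldType) (a b p : K) (n : nat) : K :=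
  \prod_(k < n) ((a - b * p ^+ k) / (1 - p ^+ k.+1)).

Lemma qcoefS (K : numFieldType) (a b p : K) n :
  qcoef a b p n.+1 = qcoef a b p n * ((a - b * p ^+ n) / (1 - p ^+ n.+1)).
Proof. exact: big_ord_recr. Qed.

Lemma subr_expr_neq0 (K : numFieldType) (p : K) n :
  `|p| < 1 -> 1 - p ^+ n.+1 != 0.
Proof.
move=> p1; rewrite subr_eq0; apply: contraTneq (p1) => pn1.
have : `|p| ^+ n.+1 < 1 by rewrite exprn_ilt1.
by rewrite -normrX -pn1 normr1 ltxx.
Qed.

(** Numerators are at most [1 + |b| |p|^k]. With [y = |p|^(k+1) <= |p|], the inverse denominators
    are at most [1 / (1 - y) = 1 + y / (1 - y) <= 1 + y / (1 - |p|)]. Both products are thus bounded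
    uniformly in [n]. *)
Lemma qcoef_bound (R : realType) (a b p : R[i]) : `|a| <= 1 -> `|p| < 1 ->
  exists2 C : R[i], 0 <= C & forall n, `|qcoef a b p n| <= C.
Proof.
move=> a1 p1; have p0 := normr_ge0 p.
have s0 : 0 < 1 - `|p| by rewrite subr_gt0.
have d0 : 0 <= `|p| / (1 - `|p|) by rewrite divr_ge0 ?(ltW s0).
have [M M0 bM] := prod_geometric_bound (normr_ge0 b) p0 p1.
have [N N0 bN] := prod_geometric_bound d0 p0 p1.
exists (M * N) => [|n]; first exact: mulr_ge0.
have ge1 (c : R[i]) : 0 <= c -> forall k : nat, 0 <= 1 + c * `|p| ^+ k.
  by move=> c0 k; rewrite addr_ge0// mulr_ge0// exprn_ge0.
rewrite (@le_trans _ _ ((\prod_(k < n) (1 + `|b| * `|p| ^+ k)) *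
    (\prod_(k < n) (1 + `|p| / (1 - `|p|) * `|p| ^+ k))))//; last first.
  by rewrite ler_pM// prodr_ge0// => k _; exact: ge1.
rewrite -big_split normr_prod ler_prod//= => k _; rewrite normr_ge0 normrM/=.
rewrite ler_pM//.
  by rewrite (le_trans (ler_normB _ _))// normrM normrX lerD.
have pk1 : `|p| ^+ k.+1 <= `|p| by rewrite exprS ler_piMr// exprn_ile1// ltW.
have den : 1 - `|p| ^+ k.+1 <= `|1 - p ^+ k.+1|.
  by rewrite (le_trans _ (lerB_dist _ _))// normr1 normrX.
have den0 : 0 < 1 - `|p| ^+ k.+1 by rewrite subr_gt0 (le_lt_trans pk1).
rewrite normfV (@le_trans _ _ (1 - `|p| ^+ k.+1)^-1)//.
  by rewrite lef_pV2// posrE (lt_le_trans den0).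
rewrite -[leLHS]mul1r ler_pdivrMr//.
have -> : `|p| / (1 - `|p|) * `|p| ^+ k = `|p| ^+ k.+1 / (1 - `|p|).
  by rewrite exprS mulrAC.
rewrite mulrDl mul1r -lerBlDl opprB addrC subrK.
rewrite -[leLHS](mulfVK (lt0r_neq0 s0)) ler_wpM2l ?lerB//.
by rewrite divr_ge0 ?exprn_ge0// ltW.
Qed.

(** Truncated form of [f(x) - f(p x) = x (a f(x) - b f(p x))]: the factor [1 - p^k] cancels the last
    denominator of the [k]-th coefficient, lowering the index by one. *)
Lemma qcoef_series_step (K : numFieldType) (a b p x : K) n : `|p| < 1 ->
  \sum_(k < n.+1) qcoef a b p k * x ^+ k
    - \sum_(k < n.+1) qcoef a b p k * (x * p) ^+ k =
  x * (a * (\sum_(k < n) qcoef a b p k * x ^+ k)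
       - b * \sum_(k < n) qcoef a b p k * (x * p) ^+ k).
Proof.
move=> p1; rewrite -sumrB big_ord_recl/= !expr0 subrr add0r.
rewrite !mulr_sumr -sumrB mulr_sumr; apply: eq_bigr => k _.
rewrite /bump/= add1n qcoefS !exprMn exprS.
by have := subr_expr_neq0 k p1; rewrite !exprS => pk; field.
Qed.

(* The series [f] satisfies [(1 - a x) f(x) = (1 - b x) f(p x)], and
   [f(p^m x)] tends to [f(0) = 1]. *)
Lemma qbinomial_series (R : realType) (a b p x : R[i]) :
  `|a| <= 1 -> `|p| < 1 -> `|x| < 1 ->
  exists2 L, tendsto (fun n => \sum_(k < n) qcoef a b p k * x ^+ k) L &
    L * qpoch_inf (a * x) p = qpoch_inf (b * x) p.
Proof.
move=> a1 p1 x1; have [C C0 cC] := qcoef_bound b a1 p1.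
pose s y n := \sum_(k < n) qcoef a b p k * y ^+ k.
have sE n : `|x * p ^+ n| <= `|x|.
  by rewrite normrM normrX ler_piMr// exprn_ile1// ltW.
have ex_f m : exists L, tendsto (s (x * p ^+ m)) L /\
    `|L - 1| <= C * (`|x| / (1 - `|x|)) * `|p| ^+ m.
  have y1 : `|x * p ^+ m| < 1 by rewrite (le_lt_trans (sE m)).
  have [n|L sL bL] := @geometric_steps_cvg R (s (x * p ^+ m)) C _
      (normr_ge0 _) y1.
    by rewrite /s big_ord_recr/= [X in `|X - _|]addrC addrK normrM normrX ler_wpM2r ?exprn_ge0.
  (* The one-term partial sum is 1, so the rate at [n = 1] bounds [L - 1]. *)
  exists L; split => //; have := bL 1%N.
  rewrite /s big_ord1 /qcoef big_ord0 mul1r expr0 expr1 distrC => /le_trans; apply.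
  rewrite [X in C * X / _]normrM normrX -!mulrA ler_wpM2l// ler_wpM2l//.
  rewrite mulrC ler_wpM2r ?exprn_ge0// lef_pV2 ?posrE ?subr_gt0//.
  by rewrite lerB// -normrX -normrM.
have [f fP] := choice ex_f.
have f_step m : f m * (1 - a * x * p ^+ m) = (1 - b * x * p ^+ m) * f m.+1.
  have [[sm _] [sm1 _]] := (fP m, fP m.+1).
  have lhs := tendstoB (tendsto_comp (f := S) (fun _ _ => id) sm)
                       (tendsto_comp (f := S) (fun _ _ => id) sm1).
  have rhs := tendstoM (tendsto_cst (x * p ^+ m))
    (tendstoB (tendstoM (tendsto_cst a) sm) (tendstoM (tendsto_cst b) sm1)).
  have E : f m - f m.+1 = x * p ^+ m * (a * f m - b * f m.+1).
    apply: tendsto_unique lhs _; rewrite (_ : (fun n => _) = (fun n => x * p ^+ m *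
      (a * s (x * p ^+ m) n - b * s (x * p ^+ m.+1) n)))//.
    apply/funext => n /=; rewrite /s exprSr mulrA.
    by rewrite qcoef_series_step.
  apply/eqP; rewrite -subr_eq0; apply/eqP.
  transitivity (f m - f m.+1 - x * p ^+ m * (a * f m - b * f m.+1)); first by ring.
  by rewrite E subrr.
have f_iter m : f 0%N * qpoch (a * x) p m = qpoch (b * x) p m * f m.
  elim: m => [|m ihm]; first by rewrite /qpoch !big_ord0 mulr1 mul1r.
  by rewrite !qpochS mulrA ihm -[LHS]mulrA f_step mulrA.
have f1 : tendsto f 1.
  apply: tendsto_squeeze (fun m => (fP m).2) _.
  exact: tendsto_geometric.
exists (f 0%N); first by have := (fP 0%N).1; rewrite expr0 mulr1.
(* Let [m] tend to infinity in [f_iter]. *)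
have lhs := tendstoM (tendsto_cst (f 0%N)) (qpoch_cvg (a * x) p1).
rewrite -[RHS]mulr1; apply: tendsto_unique lhs _.
rewrite (_ : (fun n => _) = (fun n => qpoch (b * x) p n * f n)).
  exact: tendstoM (qpoch_cvg _ p1) f1.
exact/funext.
Qed.

Lemma qcoef_qpoch (K : numFieldType) (b p : K) n :
  qcoef 1 b p n = qpoch b p n / qpoch p p n.
Proof.
rewrite /qcoef /qpoch -prodf_div; apply: eq_bigr => k _.
by rewrite exprS.
Qed.

(** The q-binomial series with [b = 0] is an explicit inverse, because [(0;p)_oo = 1]. *)
Lemma qpoch_inf_neq0 (R : realType) (u p : R[i]) :
  `|u| < 1 -> `|p| < 1 -> qpoch_inf u p != 0.
Proof.
move=> u1 p1.
have [|L _] := qbinomial_series (a := 1) 0 _ p1 u1; first by rewrite normr1.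
rewrite mul0r mul1r qpoch_inf0 => L1; apply: contraTneq isT => u0.
by move/eqP: L1; rewrite u0 mulr0 eq_sym oner_eq0.
Qed.

(** Separate even and odd powers of [q] in the first [2n] factors, then pass to the limit along even
    indices. *)
Lemma qpoch_inf_split (R : realType) (u q : R[i]) : `|q| < 1 ->
  qpoch_inf u q = qpoch_inf u (q ^+ 2) * qpoch_inf (q * u) (q ^+ 2).
Proof.
move=> q1; have p1 : `|q ^+ 2| < 1 by rewrite normrX exprn_ilt1.
have split_n n : qpoch u q n.*2 = qpoch u (q ^+ 2) n * qpoch (q * u) (q ^+ 2) n.
  elim: n => [|n ihn]; first by rewrite /qpoch !big_ord0 mulr1.
  by rewrite doubleS !qpochS ihn -!exprM mul2n [q ^+ n.*2.+1]exprS; ring.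
have dbl : {homo double : m n / (m < n)%N} by move=> m n; rewrite ltn_double.
have lhs := tendsto_comp dbl (qpoch_cvg u q1).
apply: tendsto_unique lhs _; rewrite (_ : _ \o _ = fun n =>
  qpoch u (q ^+ 2) n * qpoch (q * u) (q ^+ 2) n); last exact/funext.
by apply: tendstoM; exact: qpoch_cvg.
Qed.

(** * Row sums for fixed [i] *)

(** The [(i, j)] term of the double series without the factor [(-1)^i u^i / (q^2;q^2)_i], which is
    constant along a row. *)
Definition gauss_term (K : numFieldType) (q : K) (i j : nat) : K :=
  (-1) ^+ j * q ^ ((i%:Z - j%:Z) ^+ 2) / qpoch (q ^+ 2) (q ^+ 2) j.

Lemma sqr_distn (i j : nat) : (i%:Z - j%:Z) ^+ 2 = (`|i - j| ^ 2)%N%:Z.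
Proof. by rewrite -abszX gez0_abs// sqr_ge0. Qed.

(** With [p = q^2], the Euler coefficient is [(-1)^j p^(j(j-1)/2) / (p;p)_j], and
    [j(j-1) + j = j^2]. *)
Lemma gauss_term0 (K : numFieldType) (q : K) j : `|q| < 1 ->
  gauss_term q 0 j = qcoef 0 1 (q ^+ 2) j * q ^+ j.
Proof.
move=> q1; have p1 : `|q ^+ 2| < 1 by rewrite normrX exprn_ilt1.
rewrite /gauss_term sqr_distn distnC distn0 -exprnP.
elim: j => [|j ihj].
  by rewrite exp0n// /qcoef /qpoch !big_ord0 !expr0 invr1 !mulr1.
rewrite qcoefS qpochS -exprS sub0r mul1r exprSr invfM.
have -> : ((j.+1 ^ 2) = j ^ 2 + (2 * j + 1))%N by lia.
rewrite exprD exprD exprM [q ^+ j.+1]exprSr expr1.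
transitivity ((-1) ^+ j * q ^+ (j ^ 2) / qpoch (q ^+ 2) (q ^+ 2) j *
   (- ((q ^+ 2) ^+ j * q / (1 - (q ^+ 2) ^+ j.+1)))); first by ring.
by rewrite ihj; ring.
Qed.

(** A diagonal shift preserves [i - j], so only the sign and one factor [1 - p^(j+1)] change. *)
Lemma gauss_term_step (K : numFieldType) (q : K) i j : q != 0 -> `|q| < 1 ->
  gauss_term q i j =
    - gauss_term q i.+1 j.+1 + (q ^+ 2) ^+ j.+1 * gauss_term q i.+1 j.+1.
Proof.
move=> q0 q1; have p1 : `|q ^+ 2| < 1 by rewrite normrX exprn_ilt1.
rewrite /gauss_term qpochS -exprS [(-1) ^+ j.+1]exprSr invfM.
have -> : i.+1%:Z - j.+1%:Z = i%:Z - j%:Z by lia.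
have := subr_expr_neq0 j p1; move: (qpoch _ _ _)^-1 ((q ^+ 2) ^+ j.+1) => x y y0.
by field.
Qed.

(** Compare exponents: [2j + (i + 1 - j)^2 = 2i + 1 + (i - j)^2]. *)
Lemma gauss_term_shift (K : numFieldType) (q : K) i j : q != 0 ->
  (q ^+ 2) ^+ j * gauss_term q i.+1 j = q ^+ i.*2.+1 * gauss_term q i j.
Proof.
move=> q0; rewrite /gauss_term -exprM.
transitivity ((-1) ^+ j * (q ^+ (2 * j) * q ^ ((i.+1%:Z - j%:Z) ^+ 2)) /
  qpoch (q ^+ 2) (q ^+ 2) j); first by ring.
have -> : q ^+ (2 * j) * q ^ ((i.+1%:Z - j%:Z) ^+ 2) =
    q ^+ i.*2.+1 * q ^ ((i%:Z - j%:Z) ^+ 2).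
  rewrite !exprnP -!expfzDr//; congr (q ^ _).
  have -> : i.+1%:Z = i%:Z + 1 by lia.
  have -> : i.*2.+1%:Z = 2 * i%:Z + 1 by lia.
  have -> : (2 * j)%N%:Z = 2 * j%:Z by lia.
  by ring.
by ring.
Qed.

(** Sum the diagonal relation over [j] and rewrite its weighted part by the shift. The missing
    [j = 0] terms cancel, as the weight there is 1. *)
Lemma gauss_term_sum_step (K : numFieldType) (q : K) i n : q != 0 -> `|q| < 1 ->
  \sum_(j < n.+1) gauss_term q i.+1 j =
  q ^+ i.*2.+1 * (\sum_(j < n.+1) gauss_term q i j) - \sum_(j < n) gauss_term q i j.
Proof.
move=> q0 q1.
under [X in _ = _ - X]eq_bigr do rewrite gauss_term_step//.
rewrite mulr_sumr; under [X in _ = X - _]eq_bigr do rewrite -gauss_term_shift//.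
rewrite big_split/= sumrN !(big_ord_recl n)/= expr0 mul1r /bump/=.
by under eq_bigr do rewrite add1n; ring.
Qed.

Lemma gauss_row_sum (R : realType) (q : R[i]) i : q != 0 -> `|q| < 1 ->
  tendsto (fun n => \sum_(j < n) gauss_term q i j)
    ((-1) ^+ i * qpoch q (q ^+ 2) i * qpoch_inf q (q ^+ 2)).
Proof.
move=> q0 q1; have p1 : `|q ^+ 2| < 1 by rewrite normrX exprn_ilt1.
elim: i => [|i ihi].
  have [|L sL] := qbinomial_series (a := 0) 1 _ p1 q1; first by rewrite normr0.
  rewrite mul0r mul1r qpoch_inf0 mulr1 => <-.
  rewrite expr0 mul1r /qpoch big_ord0 mul1r.
  rewrite (_ : (fun n => _) = fun n => \sum_(k < n) qcoef 0 1 (q ^+ 2) k * q ^+ k)//.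
  by apply/funext => n; apply: eq_bigr => k _; exact: gauss_term0.
have ihS := tendsto_comp (f := S) (fun _ _ => id) ihi.
(* In the limit the row sums obey [S_(i+1) = (q^(2i+1) - 1) S_i], which supplies a sign and the next
   factor [1 - q p^i]. *)
have /= := tendstoB (tendstoM (tendsto_cst (q ^+ i.*2.+1)) ihS) ihi.
rewrite (_ : (fun n => _) = (fun n => \sum_(j < n.+1) gauss_term q i.+1 j)); last first.
  by apply/funext => n; rewrite gauss_term_sum_step.
rewrite (_ : _ - _ = (-1) ^+ i.+1 * qpoch q (q ^+ 2) i.+1 * qpoch_inf q (q ^+ 2)).
  by rewrite /tendsto (@cvg_shiftS _ (fun n => \sum_(j < n) gauss_term q i.+1 j)).
by rewrite qpochS -exprM mul2n [(-1) ^+ i.+1]exprS [q ^+ i.*2.+1]exprS; ring.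
Qed.

(* The norms live in the partially ordered [R[i]], where [max] is awkward:
   [t = 1 - (1 - a) (1 - b) / 2] serves instead. *)
Lemma common_rate (K : numFieldType) (a b : K) : 0 <= a -> a < 1 -> 0 <= b -> b < 1 ->
  exists t : K, [/\ 0 <= t, t < 1, a <= t ^+ 2 & b <= t ^+ 2].
Proof.
move=> a0 a1 b0 b1; pose c := (1 - a) * (1 - b).
have a1' : 0 < 1 - a by rewrite subr_gt0.
have b1' : 0 < 1 - b by rewrite subr_gt0.
have c0 : 0 < c by rewrite mulr_gt0.
have ca : c <= 1 - a by rewrite ler_piMr ?(ltW a1')// lerBlDr lerDl.
have cb : c <= 1 - b by rewrite ler_piMl ?(ltW b1')// lerBlDr lerDl.
have c1 : c <= 1 by rewrite (le_trans ca)// lerBlDr lerDl.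
have le_sqr : 1 - c <= (1 - c / 2) ^+ 2.
  have -> : (1 - c / 2) ^+ 2 = 1 - c + (c / 2) ^+ 2 by field.
  by rewrite lerDl exprn_ge0// divr_ge0// ltW.
exists (1 - c / 2); split.
- by rewrite subr_ge0 ler_pdivrMr// mul1r (le_trans c1)// ler1n.
- by rewrite ltrBlDr ltrDl divr_gt0.
- by rewrite (le_trans _ le_sqr)// lerBrDr addrC -lerBrDr.
- by rewrite (le_trans _ le_sqr)// lerBrDr addrC -lerBrDr.
Qed.

(** * Domination and evaluation of the double series *)

Theorem theorem3p2 (R : realType) (q u : R[i])
    (hq0 : 0 < `|q|) (hq1 : `|q| < 1) (hu : `|u| < 1) :
  has_sum
    (fun ij : nat * nat =>
       let: (i, j) := ij in
       (-1) ^+ (i + j) * u ^+ i * q ^ ((i%:Z - j%:Z) ^+ 2)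
         / (qpoch (q ^+ 2) (q ^+ 2) i * qpoch (q ^+ 2) (q ^+ 2) j))
    (qpoch_inf u q * qpoch_inf q (q ^+ 2) / qpoch_inf u (q ^+ 2) ^+ 2).
Proof.
have q0 : q != 0 by rewrite -normr_gt0.
have p1 : `|q ^+ 2| < 1 by rewrite normrX exprn_ilt1.
have [t [t0 t1 ut qt]] := common_rate (normr_ge0 u) hu (normr_ge0 q) hq1.
(* With [b = 0] the coefficients are exactly the inverses of [(q^2;q^2)_n]. *)
have [|C C0 bC] := qcoef_bound (a := 1) 0 _ p1; first by rewrite normr1.
have invC n : `|(qpoch (q ^+ 2) (q ^+ 2) n)^-1| <= C.
  by have := bC n; rewrite qcoef_qpoch qpoch0 mul1r.
have [|L sL LE] := qbinomial_series (a := 1) q _ p1 hu; first by rewrite normr1.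
apply: (@has_sum_iterated R _ (C ^+ 2) t (fun i =>
    qcoef 1 q (q ^+ 2) i * u ^+ i * qpoch_inf q (q ^+ 2)) _ t0 t1).
- move=> i j; rewrite sqr_distn -exprnP invfM !normrM !normrX normrN1 expr1n mul1r.
  rewrite [leLHS]mulrC ler_pM ?mulr_ge0 ?exprn_ge0//.
    by rewrite expr2 ler_pM.
  rewrite (@le_trans _ _ ((t ^+ 2) ^+ i * (t ^+ 2) ^+ (`|i - j| ^ 2)%N))//.
    by rewrite ler_pM ?exprn_ge0// lerXn2r// nnegrE ?exprn_ge0.
  (* As [t < 1], it remains to see [i + j <= 2i + 2(i - j)^2]; taking [|u|] and [|q|] below [t ^+ 2]
     provides the factors 2. *)
  rewrite -!exprM -exprD ler_wiXn2l// ?ltW//.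
  nia.
- move=> i; rewrite qcoef_qpoch.
  (* The sign of the term and the sign of the row sum multiply to 1. *)
  rewrite (_ : _ * _ = (-1) ^+ i * u ^+ i / qpoch (q ^+ 2) (q ^+ 2) i *
      ((-1) ^+ i * qpoch q (q ^+ 2) i * qpoch_inf q (q ^+ 2))); last first.
    transitivity (((-1) ^+ i * (-1) ^+ i) * (u ^+ i / qpoch (q ^+ 2) (q ^+ 2) i *
      (qpoch q (q ^+ 2) i * qpoch_inf q (q ^+ 2)))); last by ring.
    by rewrite -expr2 sqrr_sign; ring.
  rewrite (_ : (fun n => _) = (fun n => (-1) ^+ i * u ^+ i /
      qpoch (q ^+ 2) (q ^+ 2) i * \sum_(j < n) gauss_term q i j)).
    by apply: tendstoM; [exact: tendsto_cst|exact: gauss_row_sum].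
  apply/funext => n; rewrite mulr_sumr; apply: eq_bigr => j _.
  by rewrite /gauss_term exprD invfM; ring.
- rewrite mul1r in LE; have u0 := qpoch_inf_neq0 hu p1.
  (* The numerator becomes [(u;p)_oo^2 L (q;p)_oo], and the nonzero square cancels. *)
  rewrite (qpoch_inf_split u hq1) -LE.
  rewrite (_ : _ / _ = L * qpoch_inf q (q ^+ 2)); last by field.
  rewrite (_ : (fun n => _) = (fun n =>
      (\sum_(k < n) qcoef 1 q (q ^+ 2) k * u ^+ k) * qpoch_inf q (q ^+ 2))).
    exact: tendstoM sL (tendsto_cst _).
  by apply/funext => n; rewrite mulr_suml.
Qed.
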